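(* A topological dynamical system $(X,T)$ is mildly mixing if and only if there is no nonconstant locally SIP-rigid continuous function $f:X\to\mathbb R$.
   Context: $\mathbb N=\{1,2,\dots\}$. A topological dynamical system is a pair $(X,T)$ with $X$ a nonempty compact metric space and $T:X\to X$ a homeomorphism. It is transitive if for all nonempty open $U,V\subseteq X$ there is $n\in\mathbb N$ with $U\cap T^{-n}V\neq\emptyset$. The product of $(X,T)$ and $(Y,S)$ is $(X\times Y,T\times S)$. $(X,T)$ is mildly mixing if its product with every transitive topological dynamical system is transitive. For a strictly increasing sequence $(r_i)_{i\ge1}\subseteq\mathbb N$ and $M\in\{0,1,2,\dots\}$ let $$\operatorname{FS}_0(r_i:i>M)=\{0\}\cup\Big\{\sum_{i\in\alpha}r_i:\ \emptyset\ne\alpha\subseteq\{M+1,M+2,\dots\}\text{ finite}\Big\},$$ $$\operatorname{SIP}(r_i:i>M)=\{a-b>0:\ a,b\in\operatorname{FS}_0(r_i:i>M)\}.$$ For a bounded function $h$ on $X$ and nonempty $U\subseteq X$, $\|h\|_U=\sup_{x\in U}|h(x)|$. A continuous function $f:X\to\mathbb R$ is locally SIP-rigid if there are a strictly increasing sequence $(r_i)_{i\ge1}\subseteq\mathbb N$ and a nonempty open set $U\subseteq X$ such that $$\lim_{M\to\infty}\ \sup_{n\in\operatorname{SIP}(r_i:i>M)}\|f\circ T^n-f\|_U=0 .$$ *)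

(* Defs.v *)
From mathcomp Require Import all_boot all_order all_algebra finmap.
From mathcomp Require Import all_classical all_reals all_analysis.

Set Implicit Arguments.
Unset Strict Implicit.
Unset Printing Implicit Defensive.

Import Order.TTheory GRing.Theory Num.Theory.
Import numFieldNormedType.Exports.

Local Open Scope classical_set_scope.
Local Open Scope ring_scope.

Definition homeomorphism (X Y : topologicalType) (f : X -> Y) : Prop :=
  continuous f /\
  exists g : Y -> X, [/\ continuous g, cancel f g & cancel g f].

(* [metricType R] does not entail inhabitation, hence the first clause. *)
Definition is_tds (R : realType) (X : metricType R) (T : X -> X) : Prop :=
  [/\ [set: X] !=set0, compact [set: X] & homeomorphism T].

Definition topologically_transitive (X : topologicalType) (T : X -> X) : Prop :=
  forall U V : set X, open U -> open V -> U !=set0 -> V !=set0 ->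
  exists2 n : nat, (0 < n)%N & (U `&` iter n T @^-1` V) !=set0.

Definition product_map (X Y : Type) (T : X -> X) (S : Y -> Y) :
    X * Y -> X * Y :=
  fun p => (T p.1, S p.2).

(* Transitivity depends only on the topology, so the product carries the
   product topology and no product metric has to be chosen. *)
Definition mildly_mixing (R : realType) (X : metricType R) (T : X -> X) : Prop :=
  forall (Y : metricType R) (S : Y -> Y),
    is_tds S -> topologically_transitive S ->
    topologically_transitive (product_map T S).

(* Sequences are indexed from 1: the value [r 0] is never used. *)
Definition positive_increasing (r : nat -> nat) : Prop :=
  (forall i, (1 <= i)%N -> (0 < r i)%N) /\
  (forall i j, (1 <= i)%N -> (i < j)%N -> (r i < r j)%N).

Definition FS0 (r : nat -> nat) (M : nat) : set nat :=
  [set 0%N] `|`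
  [set s | exists a : {fset nat},
     [/\ a != fset0, (forall i, i \in a -> (M < i)%N) &
         s = (\sum_(i <- a) r i)%N]].

Definition SIP (r : nat -> nat) (M : nat) : set nat :=
  [set n | exists a b, [/\ FS0 r M a, FS0 r M b, (b < a)%N & n = (a - b)%N]].

(* [sup] is the supremum only for nonempty sets that are bounded above, so
   this is meaningful for nonempty [U] and [h] bounded on [U]. *)
Definition sup_norm_on (R : realType) (X : Type) (U : set X) (h : X -> R) : R :=
  sup [set `|h x| | x in U].

(* For continuous [f] on a compact space every supremum below is taken over a
   nonempty set bounded by twice the maximum of [`|f|]. *)
Definition locally_SIP_rigid (R : realType) (X : metricType R) (T : X -> X)
    (f : X -> R) : Prop :=
  exists (r : nat -> nat) (U : set X),
    [/\ positive_increasing r, open U, U !=set0 &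
        (fun M : nat =>
           sup [set sup_norm_on U ((f \o iter n T) \- f) | n in SIP r M])
          @ \oo --> (0 : R)].

(* Main.v *)
From HB Require Import structures.
Require Import Defs.
From mathcomp Require Import all_boot all_order all_algebra finmap.
From mathcomp Require Import all_classical all_reals all_analysis.
From mathcomp Require Import zify ring lra.

Set Implicit Arguments.
Unset Strict Implicit.
Unset Printing Implicit Defensive.

Import Order.TTheory GRing.Theory Num.Theory.
Import numFieldNormedType.Exports.
Local Open Scope classical_set_scope.
Local Open Scope ring_scope.

(** Both implications compare SIP sets with return time sets
    N(U, V) = {n > 0 : U meets S^-n V} of transitive systems.

    Every SIP set contains the return times of some transitive system
    ([SIP_return_times]). Thin the generators to a subsequence q in which each
    term exceeds the sum of the previous ones by an amount tending to infinity,
    and let a be the 0-1 sequence on the integers that marks the finite sums of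
    q. Shifting a by q k reproduces a on larger and larger windows, so a is
    recurrent and its orbit closure under the shift is a transitive system; a
    return to the cylinder of the sequences with a 1 at the origin takes a time
    that is a difference of two finite sums. If X is mildly mixing and f is
    rigid on U along SIP (r_i : i > M), the product with this system yields,
    for all nonempty open U' in U and W in X, a time n in that SIP set with U'
    meeting T^-n W. Take U' and W so small that f is nearly constant on each:
    as f o T^n is close to f on U, the value of f on W is close to its value
    on U'. Hence f is constant ([mixing_not_rigid]).

    Conversely, return times of a transitive system contain SIP sets
    ([return_times_SIP]), by repeatedly replacing V with its intersection with
    S^-n V, and N(V, W) contains m + N(V', V') for
    V' = V meet S^-m W. So when a product X x Y with Y transitive fails to be
    transitive, some nonempty open U, V in X and some SIP set satisfy: T^n U
    misses V for every n in the SIP set ([not_mixing_SIP]). A bump function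
    supported in V, with U shrunk so that the bump vanishes on it, is then
    rigid, the norms in the definition being exactly 0. Shrinking is impossible
    only if U is reduced to the centre x of the bump; such an x is isolated, and
    it is not periodic because a SIP set contains multiples of every positive integer, and a
    function supported at the preimage of x under T vanishes along the whole
    forward orbit of x ([SIP_avoiding_rigid]). *)

(** * Finite sums of a sequence and of its sparse subsequences *)

Lemma FS0P (r : nat -> nat) (M s : nat) :
  FS0 r M s <->
  exists2 a : {fset nat}, (forall i, i \in a -> (M < i)%N)
    & s = (\sum_(i <- a) r i)%N.
Proof.
split=> [[->|[a [_ aM ->]]]|[a aM ->]]; last 2 first.
- by exists a.
- have [->|a0] := eqVneq a fset0; first by rewrite big_seq_fset0; left.
  by right; exists a.
by exists fset0; rewrite ?big_seq_fset0.
Qed.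

Lemma SIP_subset (r : nat -> nat) (M : nat) : SIP r M `<=` SIP r 0.
Proof.
move=> n [a [b [/FS0P[A AM ->] /FS0P[B BM ->] ba ->]]].
exists (\sum_(i <- A) r i)%N, (\sum_(i <- B) r i)%N; split => //; apply/FS0P.
- by exists A => // i /AM; lia.
- by exists B => // i /BM; lia.
Qed.

Lemma positive_increasing_geq (r : nat -> nat) (i : nat) :
  positive_increasing r -> (0 < i)%N -> (i <= r i)%N.
Proof.
case=> rpos rinc; case: i => // i _; elim: i => [|i IH]; first exact: rpos.
by apply: leq_ltn_trans IH _; exact: rinc.
Qed.

(** Index and running total of the greedy thinning of [r] beyond [M]: since
    [r i >= i], an index larger than the total chosen so far gives a term
    larger than that total. *)
Fixpoint sparse_total (r : nat -> nat) (M k : nat) : nat :=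
  if k is k'.+1 then
    (sparse_total r M k' + r (M + k'.+1 + sparse_total r M k'))%N
  else 0%N.

Definition sparse_index (r : nat -> nat) (M k : nat) : nat :=
  (M + k.+1 + sparse_total r M k)%N.

Fixpoint subset_sums (q : nat -> nat) (k : nat) : seq nat :=
  if k is k'.+1 then
    subset_sums q k' ++ [seq (q k' + s)%N | s <- subset_sums q k']
  else [:: 0%N].

Lemma subset_sums_FS0 (r : nat -> nat) (M k s : nat) :
  s \in subset_sums (r \o sparse_index r M) k -> FS0 r M s.
Proof.
suff: s \in subset_sums (r \o sparse_index r M) k ->
    exists2 a : {fset nat},
      (forall i, i \in a -> (M < i < sparse_index r M k)%N)
      & s = (\sum_(i <- a) r i)%N.
  move=> /[apply] -[a aM ->]; apply/FS0P; exists a => // i /aM; lia.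
have inc j : (sparse_index r M j < sparse_index r M j.+1)%N.
  rewrite /sparse_index /=; lia.
elim: k s => [|k IH] s /=; rewrite ?inE.
  by move=> /eqP ->; exists fset0; rewrite ?big_seq_fset0.
rewrite mem_cat => /orP[/IH[a aM ->]|/mapP[t /IH[a aM ->] ->]].
  by exists a => // i /aM; have := inc k; lia.
exists (sparse_index r M k |` a)%fset => [i|].
  by rewrite !inE => /predU1P[->|/aM]; have := inc k; rewrite /sparse_index; lia.
by rewrite big_fsetU1//=; apply/negP => /aM; lia.
Qed.

Definition sparse (q : nat -> nat) : Prop :=
  forall k, (k + \sum_(j < k) q j < q k)%N.

Lemma sparse_subsequence (r : nat -> nat) (M : nat) :
  positive_increasing r -> sparse (r \o sparse_index r M).
Proof.
move=> hr k; have -> : (\sum_(j < k) (r \o sparse_index r M) j)%N = sparse_total r M k.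
  by elim: k => [|k IH]; rewrite ?big_ord0// big_ord_recr /= IH.
have : (sparse_index r M k <= r (sparse_index r M k))%N.
  by apply: positive_increasing_geq => //; rewrite /sparse_index; lia.
by rewrite /= {1}/sparse_index; lia.
Qed.

Definition all_subset_sums (q : nat -> nat) : set nat :=
  [set s | exists k, s \in subset_sums q k].

Lemma subset_sums_bound (q : nat -> nat) (k s : nat) :
  s \in subset_sums q k -> (s <= \sum_(j < k) q j)%N.
Proof.
elim: k s => [|k IH] s /=; first by rewrite inE big_ord0 => /eqP ->.
rewrite big_ord_recr /= mem_cat => /orP[/IH h|/mapP[t /IH h ->]].
  exact: leq_trans h (leq_addr _ _).
by rewrite addnC leq_add2r.
Qed.

(** A sum that uses a term of index at least [k] is at least [q k], so the
    smaller sums only use the first [k] terms. *)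
Lemma all_subset_sums_below (q : nat -> nat) (k s : nat) : sparse q ->
  (s < q k)%N -> all_subset_sums q s -> s \in subset_sums q k.
Proof.
move=> hq sk [l]; have [lk|kl] := leqP l k.
  move=> sl; rewrite -(subnKC lk); elim: (k - l)%N => [|d IH]; first by rewrite addn0.
  by rewrite addnS /= mem_cat IH.
rewrite -(subnKC (ltnW kl)); elim: (l - k)%N => [|d IH]; first by rewrite addn0.
rewrite addnS /= mem_cat => /orP[//|/mapP[t _ st]].
have : (q k <= q (k + d))%N.
  case: d {IH st} => [|d]; first by rewrite addn0.
  have := hq (k + d.+1)%N; have kd : (k < k + d.+1)%N by lia.
  by rewrite (bigD1 (Ordinal kd)) //=; lia.
lia.
Qed.

(** Around [q k] the set of sums looks as it does around 0: a sum close to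
    [q k] uses [q k], since the smaller terms have too small a total, and no
    later term, since these are too large. *)
Lemma all_subset_sums_recurrent (q : nat -> nat) (k : nat) : sparse q ->
  forall i : nat, (i <= k)%N ->
    (all_subset_sums q (q k + i)%N <-> all_subset_sums q i) /\
    ((0 < i)%N -> ~ all_subset_sums q (q k - i)%N).
Proof.
move=> hq i ik; have hk := hq k; have hk1 := hq k.+1.
rewrite big_ord_recr /= in hk1.
split; [split|].
- move=> /(@all_subset_sums_below _ k.+1 _ hq).
  rewrite /= mem_cat => /(_ ltac:(lia)) /orP[/subset_sums_bound|]; first lia.
  by move=> /mapP[t tk /addnI ->]; exists k.
- move=> /(@all_subset_sums_below _ k _ hq) => /(_ ltac:(lia)) h.
  by exists k.+1; rewrite /= mem_cat map_f ?orbT.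
- move=> i0 /(@all_subset_sums_below _ k _ hq) => /(_ ltac:(lia)).
  by move=> /subset_sums_bound; lia.
Qed.

(** * The orbit closure of a 0-1 sequence under the shift *)

Definition shift (p : int) (z : int -> bool) : int -> bool := fun i => z (i + p).

Definition agree (k : nat) (z w : int -> bool) : Prop :=
  forall i : int, (absz i < k)%N -> z i = w i.

Lemma agree_sym k z w : agree k z w -> agree k w z.
Proof. by move=> h i /h. Qed.

Lemma agree_trans k w z v : agree k z w -> agree k w v -> agree k z v.
Proof. by move=> h1 h2 i ik; rewrite h1 // h2. Qed.

Lemma agree_leq k l z w : (k <= l)%N -> agree l z w -> agree k z w.
Proof. by move=> kl h i ik; apply: h; apply: leq_trans kl. Qed.

Lemma agree_shift k p z w : agree (k + absz p) z w -> agree k (shift p z) (shift p w).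
Proof. by move=> h i ik; apply: h; lia. Qed.

Lemma shift_shift p q z : shift p (shift q z) = shift (p + q) z.
Proof. by apply/funext => i; rewrite /shift addrA. Qed.

(** The closure of the orbit of [a] for pointwise convergence, described by
    windows. The field [R] is a parameter of the type because the metric
    structure inferred from the type takes its values in [R]. *)
Definition orbit_closure (R : realType) (a : int -> bool) : Type :=
  {z : int -> bool | forall k, exists p, agree k z (shift p a)}.

Lemma orbit_closure_inj (R : realType) a (z w : orbit_closure R a) :
  (forall k, agree k (sval z) (sval w)) -> z = w.
Proof.
case: z w => [z hz] [w hw] /= h.
have zw : z = w by apply/funext => i; exact: (h (absz i).+1).
by subst w; congr exist; exact: Prop_irrelevance.
Qed.

(** The infimum is 0 when the sequences are equal, so that no case distinction
    is needed; otherwise it is [k.+1%:R^-1] for the largest window radius [k]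
    on which they agree. *)
Definition shift_dist (R : realType) (a : int -> bool) (z w : orbit_closure R a) : R :=
  inf [set k.+1%:R^-1 | k in [set k | agree k (sval z) (sval w)]].

Lemma shift_dist_lt (R : realType) a (z w : orbit_closure R a) (e : R) :
  shift_dist z w < e <->
  exists2 k : nat, agree k (sval z) (sval w) & k.+1%:R^-1 < e.
Proof.
have hinf : has_inf [set (k.+1%:R^-1 : R) | k in [set k | agree k (sval z) (sval w)]].
  split; first by exists 1; exists 0%N => //=; rewrite invr1.
  by exists 0 => _ [k _ <-]; rewrite invr_ge0.
split=> [|[k kzw ke]].
  by move=> /(inf_lt hinf.1)[_ [k kzw <-] ke]; exists k.
apply: le_lt_trans ke; apply: ge_inf; first exact: hinf.2.
by exists k.
Qed.

Lemma shift_dist_ge0 (R : realType) a (z w : orbit_closure R a) : 0 <= shift_dist z w.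
Proof.
rewrite leNgt; apply/negP => /shift_dist_lt[k _].
by rewrite ltNge invr_ge0 ler0n.
Qed.

Lemma shift_distxx (R : realType) a (z : orbit_closure R a) : shift_dist z z = 0.
Proof.
apply/eqP; rewrite eq_le shift_dist_ge0 andbT; apply/ler_addgt0Pl => e e0.
rewrite addr0; apply/ltW/shift_dist_lt; exists (Num.truncn e^-1) => //.
by rewrite invf_plt ?posrE ?ltr0n // truncnS_gt.
Qed.

Lemma shift_dist_small (R : realType) a (z w : orbit_closure R a) k :
  shift_dist z w < k.+1%:R^-1 -> agree k (sval z) (sval w).
Proof.
move=> /shift_dist_lt[l + lk]; apply: agree_leq.
by rewrite ltf_pV2 ?posrE ?ltr0n // ltr_nat in lk; lia.
Qed.

Lemma shift_dist_positivity (R : realType) a (z w : orbit_closure R a) :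
  shift_dist z w = 0 -> z = w.
Proof.
move=> zw; apply: orbit_closure_inj => k; apply: shift_dist_small.
by rewrite zw invr_gt0.
Qed.

Lemma shift_dist_sym (R : realType) a (z w : orbit_closure R a) :
  shift_dist z w = shift_dist w z.
Proof.
by congr inf; apply/seteqP; split => _ [k kzw <-]; exists k => //; apply: agree_sym.
Qed.

Lemma shift_dist_triangle (R : realType) a (w z v : orbit_closure R a) :
  shift_dist z v <= shift_dist z w + shift_dist w v.
Proof.
apply/ler_addgt0Pl => e e0.
have /shift_dist_lt[k kzw ke] : shift_dist z w < shift_dist z w + e / 2.
  by rewrite ltrDl divr_gt0.
have /shift_dist_lt[l lwv le] : shift_dist w v < shift_dist w v + e / 2.
  by rewrite ltrDl divr_gt0.
apply/ltW/shift_dist_lt; exists (minn k l).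
  apply: (@agree_trans _ (sval w)).
    exact: agree_leq (geq_minl _ _) kzw.
  exact: agree_leq (geq_minr _ _) lwv.
apply: (@lt_trans _ _ (k.+1%:R^-1 + l.+1%:R^-1)); last first.
  by rewrite [e]splitr [ltRHS]addrC addrACA ltrD.
by case: (leqP k l) => _; rewrite ?ltrDl ?ltrDr invr_gt0.
Qed.

HB.instance Definition _ (R : realType) a := gen_eqMixin (orbit_closure R a).
HB.instance Definition _ (R : realType) a := gen_choiceMixin (orbit_closure R a).
HB.instance Definition _ (R : realType) a :=
  @isMetric.Build R (orbit_closure R a) (@shift_dist R a) (@shift_distxx R a)
    (@shift_dist_positivity R a) (@shift_dist_sym R a) (@shift_dist_triangle R a).

Lemma orbit_closure_nbhsP (R : realType) a (z : orbit_closure R a) (A : set (orbit_closure R a)) :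
  nbhs z A <-> exists k, forall w, agree k (sval z) (sval w) -> A w.
Proof.
rewrite -filter_from_ballE; split=> [[e /= e0 zA]|[k kA]].
  exists (Num.truncn e^-1) => w zw; apply: zA; rewrite ballEmdist /=.
  apply/shift_dist_lt; exists (Num.truncn e^-1) => //.
  by rewrite invf_plt ?posrE ?ltr0n // truncnS_gt.
exists k.+1%:R^-1; first by rewrite /= invr_gt0.
by move=> w; rewrite ballEmdist /= => /shift_dist_small /kA.
Qed.

(** Along an ultrafilter each coordinate is eventually constant; these
    constants form the limit, which stays in the orbit closure because each of
    its windows is a window of some point of the orbit closure. *)
Lemma orbit_closure_compact (R : realType) a : compact [set: orbit_closure R a].
Proof.
rewrite compact_ultra => F UF _.
pose z (i : int) : bool := `[< F [set w : orbit_closure R a | sval w i] >].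
have zi i : F [set w | z i = sval w i].
  rewrite /z; have [Fi|nFi] := pselect (F [set w : orbit_closure R a | sval w i]).
    by apply: filterS (Fi) => w /= wi; rewrite wi; exact/asboolP.
  have [//|] := in_ultra_setVsetC [set w : orbit_closure R a | sval w i] UF.
  apply: filterS => w /= /negP/negbTE ->; exact/asboolPn.
have zF k : F [set w | agree k z (sval w)].
  elim: k => [|k IH]; first by apply: filterS filterT => w _ i.
  apply: filterS (filterI IH (filterI (zi k%:Z) (zi (- k%:Z)))).
  move=> w [h [h1 h2]] i ik.
  have [|] : (absz i < k)%N \/ (i = k%:Z \/ i = - k%:Z) by lia.
    exact: h.
  by case=> ->.
have zY k : exists p, agree k z (shift p a).
  have [w zw] := filter_ex (zF k); have [p wp] := svalP w k.
  by exists p; exact: agree_trans zw wp.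
exists (exist _ z zY); split => // A /orbit_closure_nbhsP[k kA].
by apply: filterS (zF k) => w; exact: kA.
Qed.

Lemma orbit_closure_shift a (q : int) (z : int -> bool) :
  (forall k, exists p, agree k z (shift p a)) ->
  forall k, exists p, agree k (shift q z) (shift p a).
Proof.
move=> hz k; have [p zp] := hz (k + absz q)%N; exists (q + p).
by rewrite -shift_shift; exact: agree_shift.
Qed.

Definition shift_map (R : realType) a (q : int) (z : orbit_closure R a) : orbit_closure R a :=
  exist _ (shift q (sval z)) (orbit_closure_shift q (svalP z)).

Lemma shift_map_continuous (R : realType) a q : continuous (@shift_map R a q).
Proof.
move=> z A /orbit_closure_nbhsP[k kA]; apply/orbit_closure_nbhsP.
by exists (k + absz q)%N => w zw; apply: kA; exact: agree_shift.
Qed.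

Lemma shift_mapK (R : realType) a p q : p + q = 0 -> cancel (@shift_map R a q) (shift_map p).
Proof.
move=> pq z; apply: orbit_closure_inj => k i _ /=.
by rewrite shift_shift pq /shift addr0.
Qed.

Lemma iter_shift_map (R : realType) a n (z : orbit_closure R a) :
  sval (iter n (shift_map 1) z) = shift n%:Z (sval z).
Proof.
elim: n => [|n IH] /=; first by apply/funext => i; rewrite /shift addr0.
by rewrite IH shift_shift; congr shift; lia.
Qed.

Lemma orbit_closure_self a k : exists p, agree k a (shift p a).
Proof. by exists 0 => i _; rewrite /shift addr0. Qed.

Definition orbit_closure_base (R : realType) a : orbit_closure R a :=
  exist _ a (orbit_closure_self a).

Lemma shift_map_tds (R : realType) a : is_tds (@shift_map R a 1).
Proof.
split; first by exists (orbit_closure_base R a).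
- exact: orbit_closure_compact.
- split; first exact: shift_map_continuous.
  exists (shift_map (-1)); split; first exact: shift_map_continuous.
  + exact: shift_mapK.
  + exact: shift_mapK.
Qed.

Definition recurrent_sequence (a : int -> bool) : Prop :=
  forall k N : nat, exists2 n : nat, (N < n)%N & agree k a (shift n%:Z a).

(** Nonempty open sets contain shifts of [a] by some [p] and [q]; recurrence
    replaces [q] by [q + m] with [m] large, so that the second shift is
    reached from the first one in positive time. *)
Lemma shift_map_transitive (R : realType) a :
  recurrent_sequence a -> topologically_transitive (@shift_map R a 1).
Proof.
move=> ha U V Uo Vo [z Uz] [w Vw].
have /orbit_closure_nbhsP[k1 kU] : nbhs z U by exact: open_nbhs_nbhs.
have /orbit_closure_nbhsP[k2 kV] : nbhs w V by exact: open_nbhs_nbhs.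
have [p zp] := svalP z k1; have [q wq] := svalP w k2.
have [m mN am] := ha (k2 + absz q)%N (absz (q - p)).
exists (absz (m%:Z + (q - p))); first by lia.
exists (shift_map p (orbit_closure_base R a)); split; first exact: kU.
apply: kV; rewrite iter_shift_map /= shift_shift.
have -> : (absz (m%:Z + (q - p)) : int) + p = q + m by lia.
by rewrite -shift_shift; apply: agree_trans wq _; exact: agree_shift.
Qed.

(** * Transitive systems whose return times lie in a SIP set *)

Definition indicator_seq (A : set nat) : int -> bool :=
  fun i => if i is Posz n then `[< A n >] else false.

Lemma indicator_recurrent (q : nat -> nat) : sparse q ->
  recurrent_sequence (indicator_seq (all_subset_sums q)).
Proof.
move=> hq k N; exists (q (maxn k N)); first by have := hq (maxn k N); lia.
move=> i ik; rewrite /shift /indicator_seq.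
have qk := hq (maxn k N).
have [h1 h2] := @all_subset_sums_recurrent q (maxn k N) hq (absz i) ltac:(lia).
case: i ik h1 h2 => [i|i] ik h1 h2.
  have -> : Posz i + q (maxn k N) = Posz (q (maxn k N) + i) by lia.
  by apply: asbool_equiv_eq; rewrite h1.
have -> : Negz i + q (maxn k N) = Posz (q (maxn k N) - i.+1) by lia.
by symmetry; apply/asboolPn; exact: h2.
Qed.

(** The set [V] is the cylinder of the sequences with value 1 at 0: its
    return times are the distances between two 1s of the generating
    sequence. *)
Lemma SIP_return_times (R : realType) (r : nat -> nat) (M : nat) :
  positive_increasing r ->
  exists (Y : metricType R) (S : Y -> Y) (V : set Y),
    [/\ is_tds S, topologically_transitive S, open V, V !=set0 &
        forall y n, (0 < n)%N -> V y -> V (iter n S y) -> SIP r M n].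
Proof.
move=> hr; pose q := r \o sparse_index r M; pose a := indicator_seq (all_subset_sums q).
have hq : sparse q by exact: sparse_subsequence.
exists (orbit_closure R a), (shift_map 1), [set z : orbit_closure R a | sval z 0]; split.
- exact: shift_map_tds.
- by apply: shift_map_transitive; exact: indicator_recurrent.
- rewrite openE => z z0; apply/orbit_closure_nbhsP; exists 1%N => w zw /=.
  by rewrite -zw.
- exists (orbit_closure_base R a); apply/asboolP; exists 0%N; exact: mem_head.
move=> y n n0 /= y0; rewrite iter_shift_map {1}/shift add0r => yn.
(* The radius n.+1 makes the window of y contain both 0 and n. *)
have [p yp] := svalP y n.+1; move: y0 yn; rewrite !yp //.
rewrite /shift add0r => ap anp.
case: p {yp} ap anp => // p /asboolP[k pk] /asboolP[l pnl].
exists (n + p)%N, p; split; last 2 first; [lia | lia | |].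
- exact: (@subset_sums_FS0 r M l).
- exact: (@subset_sums_FS0 r M k).
Qed.

(** * SIP sets inside the return times of a transitive map *)

Lemma iter_continuous (X : topologicalType) (T : X -> X) (n : nat) :
  continuous T -> continuous (iter n T).
Proof.
move=> Tc; elim: n => [|n IH] x; first exact: cvg_id.
by apply: (@continuous_comp _ _ _ (iter n T) T); [exact: IH|exact: Tc].
Qed.

Lemma open_preimage (X Y : topologicalType) (f : X -> Y) (V : set Y) :
  continuous f -> open V -> open (f @^-1` V).
Proof. by move=> /continuousP; apply. Qed.

(** A return to the set of points that are back in [V] after time [n] gives a
    return to [V] whose time is larger by [n], so return times are
    unbounded. *)
Lemma transitive_late_return (Y : topologicalType) (S : Y -> Y) (V : set Y) (N : nat) :
  continuous S -> topologically_transitive S -> open V -> V !=set0 ->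
  exists2 n : nat, (N < n)%N & (V `&` iter n S @^-1` V) !=set0.
Proof.
move=> Sc St; elim: N V => [|N IH] V Vo V0; first exact: St.
have [n n0 W0] := St _ _ Vo Vo V0 V0.
have [|m mN [y [[Vy _] [_ Vny]]]] := IH (V `&` iter n S @^-1` V) _ W0.
  by apply: openI => //; apply: open_preimage => //; exact: iter_continuous.
exists (n + m)%N; first by lia.
by exists y; split => //=; rewrite iterD.
Qed.

Lemma fset_bound (a : {fset nat}) : exists k, forall i, i \in a -> (i <= k)%N.
Proof. by exists (\max_(i <- a) i) => i ia; exact: leq_bigmax_seq. Qed.

(** Choose [r k.+1] as a return time of V_k, and V_k.+1 as the points of V_k
    that return to V_k at this time. A point of V_k then visits [V] at every
    sum of distinct terms among [r 1], ..., [r k]; the difference of two such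
    times is a return time of [V]. *)
Lemma return_times_SIP (Y : topologicalType) (S : Y -> Y) (V : set Y) :
  continuous S -> topologically_transitive S -> open V -> V !=set0 ->
  exists2 r : nat -> nat, positive_increasing r &
    forall n, SIP r 0 n -> (V `&` iter n S @^-1` V) !=set0.
Proof.
move=> Sc St Vo V0.
(* A state is the pair (V_k, r k); r 0 = 0 is never summed and only starts
   the strict increase. *)
pose step (p q : set Y * nat) := open p.1 -> p.1 !=set0 ->
  [/\ open q.1, q.1 !=set0, (p.2 < q.2)%N & q.1 `<=` p.1 `&` iter q.2 S @^-1` p.1].
have stepP p : {q | step p q}.
  apply: cid; case: p => W N; rewrite /step /=.
  have [Wo|nWo] := pselect (open W); last by exists (W, N).
  have [W0|nW0] := pselect (W !=set0); last by exists (W, N).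
  have [n nN n0] := transitive_late_return N Sc St Wo W0.
  exists (W `&` iter n S @^-1` W, n) => _ _; split => //=.
  by apply: openI => //; apply: open_preimage => //; exact: iter_continuous.
pose st := fix st k := if k is k'.+1 then sval (stepP (st k')) else (V, 0%N).
have stO k : open (st k).1 /\ (st k).1 !=set0.
  by elim: k => [|k [ko k0]] //=; case: (stepP _) => q /= [].
have stS k : ((st k).2 < (st k.+1).2)%N /\
    (st k.+1).1 `<=` (st k).1 `&` iter (st k.+1).2 S @^-1` (st k).1.
  by have [ko k0] := stO k; rewrite /=; case: (stepP _) => q /= [].
pose r k := (st k).2.
have rinc i j : (i < j)%N -> (r i < r j)%N.
  elim: j => // j IH; rewrite ltnS leq_eqVlt => /predU1P[->|/IH ij].
    exact: (stS j).1.
  exact: ltn_trans ij (stS j).1.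
exists r.
  split=> [i i1|i j _]; last exact: rinc.
  exact: leq_ltn_trans (rinc _ _ i1).
have stV k (a : {fset nat}) y : (forall i, i \in a -> (0 < i <= k)%N) ->
    (st k).1 y -> V (iter (\sum_(i <- a) r i)%N S y).
  elim: k a y => [|k IH] a y ak sy.
    suff -> : a = fset0 by rewrite big_seq_fset0.
    by apply/fsetP => i; rewrite inE; apply/negP => /ak; lia.
  have [sy1 sy2] := (stS k).2 _ sy.
  have [ka|ka] := boolP (k.+1 \in a); last first.
    apply: IH sy1 => i ia; have := ak i ia.
    by have : i != k.+1 by [apply: contraNneq ka => <-]; lia.
  rewrite (big_fsetD1 k.+1) //= addnC iterD; apply: IH sy2 => i.
  by rewrite !inE => /andP[ik /ak]; lia.
move=> n [_ [_ [/FS0P[a a0 ->] /FS0P[b b0 ->] ba ->]]].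
have [k ak] := fset_bound a; have [l bl] := fset_bound b.
have [y sy] := (stO (maxn k l)).2.
exists (iter (\sum_(i <- b) r i)%N S y); split => /=.
  by apply: stV sy => i ib; have := b0 i ib; have := bl i ib; lia.
rewrite -iterD subnK ?(ltnW ba) //.
by apply: stV sy => i ia; have := a0 i ia; have := ak i ia; lia.
Qed.

(** By the pigeonhole principle, two of the first [p.+1] partial sums of [r]
    are congruent modulo [p]. *)
Lemma SIP_multiple (r : nat -> nat) (p : nat) : positive_increasing r -> (0 < p)%N ->
  exists2 n : nat, (0 < n)%N & SIP r 0 (n * p)%N.
Proof.
move=> hr p0; pose s k := (\sum_(i < k) r i.+1)%N.
have sS k : s k.+1 = (s k + r k.+1)%N by rewrite /s big_ord_recr.
have sinc i j : (i < j)%N -> (s i < s j)%N.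
  elim: j => // j IH; rewrite ltnS leq_eqVlt sS.
  by have := hr.1 j.+1 isT; move=> rj /predU1P[->|/IH]; lia.
have sFS k : FS0 r 0 (s k).
  apply/FS0P; exists [fset i.+1 | i in iota 0 k]%fset => [i /imfsetP[j _ ->] //|].
  rewrite big_imfset /=; last by move=> i j _ _ [].
  rewrite /s -(big_mkord xpredT (fun i => r i.+1)) /index_iota subn0.
  apply: perm_big; apply: uniq_perm; rewrite ?undup_uniq ?iota_uniq // => i.
  by rewrite mem_undup.
have [i [j [ij]]] : exists i j, (i < j)%N /\ s i = s j %[mod p].
  pose f (i : 'I_p.+1) : 'I_p := Ordinal (ltn_pmod (s i) p0).
  have /injectivePn[i [j ij fij]] : ~~ injectiveb f.
    apply/injectiveP => /leq_card; rewrite !card_ord; lia.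
  have sij : s i = s j %[mod p] by have := congr1 val fij.
  have [lt|lt|eq] := ltngtP i j.
  - by exists i, j.
  - by exists j, i.
  - by move: ij; rewrite (val_inj eq) eqxx.
move=> /esym/eqP; rewrite eqn_mod_dvd; last exact/ltnW/sinc.
move=> /dvdnP[n E]; have lt := sinc _ _ ij.
exists n; first by case: n E => // E; lia.
by rewrite -E; exists (s j), (s i); split.
Qed.

(** * Mild mixing excludes nonconstant locally SIP-rigid functions *)

Lemma continuous_on_compact_bounded (R : realType) (X : topologicalType) (f : X -> R) :
  compact [set: X] -> continuous f -> exists B : R, forall x, `|f x| <= B.
Proof.
move=> cX cf; have /compact_bounded[B [_ hB]] : compact (f @` [set: X]).
  by apply: continuous_compact => //; exact: continuous_subspaceT.
by exists (B + 1) => x; apply: (hB (B + 1)); [rewrite ltrDl|exists x].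
Qed.

Lemma open_setX (X Y : topologicalType) (A : set X) (B : set Y) :
  open A -> open B -> open (A `*` B).
Proof.
move=> Ao Bo; rewrite (_ : _ `*` _ = fst @^-1` A `&` snd @^-1` B) //.
by apply: openI; apply: open_preimage => // -[x y]; [exact: cvg_fst|exact: cvg_snd].
Qed.

(** Boundedness of [f] makes all the suprema in the definition of rigidity
    genuine upper bounds, so that rigidity controls [f] pointwise. *)
Lemma rigid_near (R : realType) (X : metricType R) (T : X -> X) (f : X -> R) :
  compact [set: X] -> continuous f -> locally_SIP_rigid T f ->
  exists (r : nat -> nat) (U : set X),
    [/\ positive_increasing r, open U, U !=set0 &
      forall e : R, 0 < e -> exists M, forall n, SIP r M n ->
        forall x, U x -> `|f (iter n T x) - f x| < e].
Proof.
move=> cX cf [r [U [hr Uo U0 lim]]]; exists r, U; split => // e e0.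
have [B fB] := continuous_on_compact_bounded cX cf.
have dB n x : `|f (iter n T x) - f x| <= B + B.
  by rewrite (le_trans (ler_normB _ _)) // lerD.
move: lim => /cvgrPdist_lt /(_ e e0)[M _ /(_ M (leqnn M))] /=.
rewrite sub0r normrN => /(le_lt_trans (ler_norm _)) hM.
exists M => n nM x Ux; apply: le_lt_trans hM.
apply: (@le_trans _ _ (sup_norm_on U ((f \o iter n T) \- f))).
  apply: ub_le_sup; last by exists x.
  by exists (B + B) => _ [y _ <-]; exact: dB.
apply: ub_le_sup; last by exists n.
exists (B + B) => _ [m _ <-]; apply: ge_sup; first by case: U0 => y Uy; exists `|f (iter m T y) - f y|, y.
by move=> _ [y _ <-]; exact: dB.
Qed.

(** If [f y] differed from the value [f x] at a point [x] of [U], a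
    time [n] leading points of [U] where [f] is near [f x] to points where [f]
    is near [f y] would lie in a SIP set along which [f] moves by less than a third of the gap. *)
Lemma mixing_not_rigid (R : realType) (X : metricType R) (T : X -> X) (f : X -> R) :
  is_tds T -> mildly_mixing T -> continuous f -> locally_SIP_rigid T f ->
  exists c, forall x, f x = c.
Proof.
move=> [_ cX _] mix cf /(rigid_near cX cf)[r [U [hr Uo [x Ux] near]]].
exists (f x) => y; apply/eqP; rewrite -subr_eq0 -normr_le0 leNgt; apply/negP.
set d := `|_| => d0; have e0 : 0 < d / 3 by rewrite divr_gt0.
have [M hM] := near _ e0.
have [Y [S [V [tS St Vo [v Vv] VM]]]] := SIP_return_times R M hr.
pose W (z : X) := [set t | `|f z - f t| < d / 3].
have Wo z : open (W z).
  rewrite (_ : W z = f @^-1` ball (f z) (d / 3)) //.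
  by apply: open_preimage => //; exact: ball_open.
have [] := mix Y S tS St ((U `&` W x) `*` V) (W y `*` V).
- apply: open_setX => //; exact: openI.
- exact: open_setX.
- by exists (x, v); split => //; split => //; rewrite /W /= subrr normr0.
- by exists (y, v); split => //; rewrite /W /= subrr normr0.
move=> n n0 [[t w] [[/= [Ut xt] Vw]]].
have -> : iter n (product_map T S) (t, w) = (iter n T t, iter n S w).
  by elim: (n) => //= k ->.
move=> [/= yt Vnw].
have nt := hM n (VM _ _ n0 Vw Vnw) t Ut.
have : d <= `|f y - f (iter n T t)| + `|f (iter n T t) - f t| + `|f x - f t|.
  rewrite (distrC (f x)) /d.
  apply: le_trans (lerD (ler_distD _ _ _) (lexx _)).
  exact: ler_distD.
apply/negP; rewrite -ltNge; rewrite [ltRHS](_ : d = d / 3 + d / 3 + d / 3).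
  by rewrite !ltrD.
by field.
Qed.

(** * Failure of mild mixing produces a locally SIP-rigid function *)

(** If the boxes [U1 `*` V1] and [U2 `*` V2] never meet under the product, fix
    a passage time [m] from [V1] to [V2]; the times [m + n], with [n] in a SIP
    set of return times of the points making this passage, are all passage
    times from [V1] to [V2], hence are forbidden from [U1] to [U2]. *)
Lemma not_mixing_SIP (R : realType) (X : metricType R) (T : X -> X) :
  is_tds T -> ~ mildly_mixing T ->
  exists (U V : set X) (r : nat -> nat),
    [/\ open U, open V, U !=set0, V !=set0 & positive_increasing r /\
      forall n, SIP r 0 n -> forall x, U x -> ~ V (iter n T x)].
Proof.
move=> [_ _ [Tc [T' [_ _ T'K]]]] nmix; apply: contrapT => noU; apply: nmix.
move=> Y S [_ _ [Sc _]] St A B Ao Bo [[x1 y1] Axy] [[x2 y2] Bxy].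
have box (C : set (X * Y)) x y : open C -> C (x, y) ->
    exists (U : set X) (V : set Y), [/\ open U, open V, U x, V y & U `*` V `<=` C].
  move=> Co Cxy; have [[U V] /= [Ux Vy] UVC] : nbhs (x, y) C by exact: open_nbhs_nbhs.
  move: Ux Vy; rewrite !nbhsE => -[U1 [U1o U1x] U1U] [V1 [V1o V1y] V1V].
  by exists U1, V1; split => // -[p q] [/= Up Vq]; apply: UVC; split; [exact: U1U|exact: V1V].
have [U1 [V1 [U1o V1o Ux1 Vy1 UV1]]] := box _ _ _ Ao Axy.
have [U2 [V2 [U2o V2o Ux2 Vy2 UV2]]] := box _ _ _ Bo Bxy.
have [m m0 V0] := St _ _ V1o V2o (ex_intro _ _ Vy1) (ex_intro _ _ Vy2).
have V0o : open (V1 `&` iter m S @^-1` V2).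
  by apply: openI => //; apply: open_preimage => //; exact: iter_continuous.
have [r hr rV] := return_times_SIP Sc St V0o V0.
apply: contrapT => noret; apply: noU.
exists U1, (iter m T @^-1` U2), r; split => //.
- by apply: open_preimage => //; exact: iter_continuous.
- by exists x1.
- exists (iter m T' x2); rewrite /= (_ : iter m T _ = x2) //.
  by elim: (m) => // k IH; rewrite iterSr /= T'K.
split => // n /rV[y [[V1y _] [_ V2y]]] x Ux U2x; apply: noret.
exists (m + n)%N; first by lia.
exists (x, y); split; first exact: UV1.
have pmE k : iter k (product_map T S) (x, y) = (iter k T x, iter k S y).
  by elim: k => //= k ->.
by rewrite /= pmE; apply: UV2; split; rewrite /= iterD.
Qed.

Lemma exact_return_rigid (R : realType) (X : metricType R) (T : X -> X) (f : X -> R)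
    (r : nat -> nat) (U : set X) :
  positive_increasing r -> open U -> U !=set0 ->
  (forall n, SIP r 0 n -> forall x, U x -> f (iter n T x) = f x) ->
  locally_SIP_rigid T f.
Proof.
move=> hr Uo U0 fU; exists r, U; split => //.
have sup_sub0 (A : set R) : A `<=` [set 0] -> sup A = 0.
  by move=> /subset_set1[] ->; rewrite ?sup0 ?sup1.
apply: cvg_near_cst; near=> M; apply/sup_sub0 => s [n /SIP_subset nr <-].
apply: sup_sub0 => t [x Ux <-].
by rewrite /= fU // subrr normr0.
Unshelve. all: by end_near.
Qed.

Definition bump (R : realType) (X : metricType R) (x : X) (e : R) (z : X) : R :=
  Num.max 0 (e - mdist x z).

Lemma bump_center (R : realType) (X : metricType R) (x : X) (e : R) :
  0 < e -> bump x e x != 0.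
Proof. by move=> e0; rewrite /bump mdistxx subr0 max_r ?ltW // gt_eqF. Qed.

Lemma bump_out (R : realType) (X : metricType R) (x z : X) (e : R) :
  ~ ball x e z -> bump x e z = 0.
Proof.
rewrite ballEmdist /= => /negP; rewrite -leNgt => h.
by rewrite /bump max_l // subr_le0.
Qed.

Lemma bump_continuous (R : realType) (X : metricType R) (x : X) (e : R) :
  continuous (bump x e).
Proof.
have mdist_continuous : continuous (mdist x).
  move=> z; apply/cvgrPdist_lt => d d0; apply/nbhs_ballP.
  exists d => //= w; rewrite ballEmdist /= => zw; apply: le_lt_trans zw.
  rewrite ler_norml; have := metric_triangle x z w; have := metric_triangle x w z.
  by rewrite (metric_sym w z) => h1 h2; apply/andP; split; lra.
move=> z; apply: (@continuous_max R X (cst 0) (fun w => e - mdist x w)).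
  exact: cvg_cst.
by apply: (@cvgB R R^o); [exact: cvg_cst|exact: mdist_continuous].
Qed.

(** A bump at a point [y] of [V] that is zero outside [V] vanishes at
    [iter n T x] for [x] in [U] and [n] in the SIP set. It vanishes on a
    nonempty open part of [U] as well, unless [U] is reduced to [y]; then [y]
    is isolated and not periodic, and the bump is precomposed with [T]. *)
Lemma SIP_avoiding_rigid (R : realType) (X : metricType R) (T : X -> X)
    (U V : set X) (r : nat -> nat) :
  is_tds T -> open U -> open V -> U !=set0 -> V !=set0 -> positive_increasing r ->
  (forall n, SIP r 0 n -> forall x, U x -> ~ V (iter n T x)) ->
  exists f : X -> R,
    [/\ continuous f, ~ (exists c, forall x, f x = c) & locally_SIP_rigid T f].
Proof.
move=> [_ _ [Tc [T' [_ TK T'K]]]] Uo Vo [x Ux] [y Vy] hr UV.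
have [ey ey0 yV] : exists2 e : R, 0 < e & ball y e `<=` V.
  by have : nbhs y V by [exact: open_nbhs_nbhs]; rewrite -filter_from_ballE.
have [[x' Ux' x'y]|Uy] := pselect (exists2 x', U x' & x' <> y).
  pose d := mdist y x' / 2.
  have d0 : 0 < d by rewrite divr_gt0 // mdist_gt0; apply/eqP => /esym.
  pose e := Num.min ey d.
  have e0 : 0 < e by rewrite lt_min ey0.
  have eV : ball y e `<=` V.
    by apply: subset_trans yV; apply: le_ball; rewrite ge_min lexx.
  have fU z : ball x' d z -> bump y e z = 0.
    move=> x'z; apply: bump_out; rewrite ballEmdist /= => /lt_le_trans.
    move=> /(_ d); rewrite ge_min lexx orbT => /(_ isT) yz.
    have := metric_triangle y z x'; rewrite leNgt => /negP; apply.
    move: x'z; rewrite ballEmdist /= (metric_sym x') => zx'.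
    by rewrite [ltRHS]splitr ltrD.
  have x'd : ball x' d x' by exact: ballxx.
  exists (bump y e); split; first exact: bump_continuous.
    move=> [c hc]; have /eqP := bump_center y e0; apply.
    by rewrite hc -(hc x') fU.
  apply: (@exact_return_rigid _ _ _ _ r (U `&` (ball x' d)°)) => //.
  - by apply: openI => //; exact: open_interior.
  - by exists x'; split => //; exact: nbhsx_ballx.
  - move=> n nr z [Uz /interior_subset zd]; rewrite (fU z) //; apply: bump_out => /eV.
    exact: UV nr z Uz.
have Uone z : U z -> z = y by move=> Uz; apply: contrapT => zy; apply: Uy; exists z.
have xy := Uone x Ux; subst y.
have [e e0 xU] : exists2 e : R, 0 < e & ball x e `<=` U.
  by have : nbhs x U by [exact: open_nbhs_nbhs]; rewrite -filter_from_ballE.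
(* A period n.+1 of x would bring x back to V at a time in the SIP set. *)
have aper n : iter n.+1 T x <> x.
  move=> nx; have [m _ /UV /(_ x Ux)] := SIP_multiple hr (ltn0Sn n); apply.
  rewrite (_ : iter _ T x = x) //; elim: m => // m IH.
  by rewrite mulSn iterD IH.
have f0 n : bump x e (iter n.+1 T x) = 0.
  by apply: bump_out => /xU /Uone; exact: aper.
exists (bump x e \o T); split.
- by move=> z; apply: continuous_comp; [exact: Tc|exact: bump_continuous].
- move=> [c hc]; have /eqP := bump_center x e0; apply.
  by have := hc (T' x); rewrite /= T'K => ->; rewrite -(hc x); exact: (f0 0%N).
- apply: (@exact_return_rigid _ _ _ _ r U) => //; first by exists x.
  by move=> n _ z /Uone ->; rewrite /= (f0 n) (f0 0%N).
Qed.

Theorem theorem2 (R : realType) (X : metricType R) (T : X -> X)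
    (hT : is_tds T) :
  mildly_mixing T <->
  ~ (exists f : X -> R,
       [/\ continuous f, ~ (exists c : R, forall x : X, f x = c) &
           locally_SIP_rigid T f]).
Proof.
split=> [mix [f [cf nf rf]]|norigid].
  by apply: nf; exact: mixing_not_rigid rf.
apply: contrapT => /(not_mixing_SIP hT)[U [V [r [Uo Vo U0 V0 [hr UV]]]]].
by apply: norigid; exact: SIP_avoiding_rigid UV.
Qed.
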